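(* In the setting described in the context, let $\mu$ be the probability distribution on $\overline{\mathbb{R}}$ of the almost surely defined limit $\zeta=\lim_{m\to\infty}z_m$. Then $$\mu=\tfrac13\big((\tau_1)_*\mu+(\tau_2)_*\mu+(\tau_3)_*\mu\big),$$ where $(\tau_i)_*\mu$ is the pushforward of $\mu$ under $\tau_i|_{\overline{\mathbb{R}}}\colon\overline{\mathbb{R}}\to\overline{\mathbb{R}}$.
   Context: Let $\mathbb{H}=\{z\in\mathbb{C}:\operatorname{Im}z>0\}$ be the Poincaré upper half-plane (metric $(dx^2+dy^2)/y^2$), $\overline{\mathbb{R}}=\mathbb{R}\cup\{\infty\}$, and $\overline{\mathbb{H}}=\mathbb{H}\cup\overline{\mathbb{R}}$ (a closed disk). A (hyperbolic) line is a set $\{z\in\mathbb{H}:\operatorname{Re}z=x\}$ or $\{z\in\mathbb{H}:|z-x|=r\}$ with $x\in\mathbb{R}$, $r>0$; its reflection $t_L$ is $t_L(z)=2x-\bar z$, resp. $t_L(z)=r^2/(\bar z-x)+x$, extended continuously to $\overline{\mathbb{H}}$. Fix lines $L_1,L_2,L_3\subseteq\mathbb{H}$ and $z_0\in\mathbb{H}$ such that for all distinct $i,i'\in\{1,2,3\}$ either (a) $L_i\cap L_{i'}=\emptyset$ and $z_0$ lies in the connected component of $\mathbb{H}\setminus(L_i\cup L_{i'})$ whose boundary contains both lines, or (b) $L_i,L_{i'}$ meet at an angle of measure $\pi/m(i,i')$ with $m(i,i')\ge2$ an integer, and $z_0$ lies in the interior of that angle. Let $s_i=t_{L_i}$, let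 $W$ be the group generated by $S=\{s_1,s_2,s_3\}$, and let $\ell$ be the word length with respect to $S$. The one-way reflection $\tau_i\colon\overline{\mathbb{H}}\to\overline{\mathbb{H}}$ is $\tau_i(z)=s_i(z)$ if $z$ and $z_0$ are on the same side of $L_i$ and $\tau_i(z)=z$ otherwise; it is continuous. Let $i_1,i_2,\ldots$ be independent uniform random elements of $\{1,2,3\}$ and $z_m=(\tau_{i_1}\circ\cdots\circ\tau_{i_m})(z_0)$ (equivalently $z_m=u_m(z_0)$ where $u_0=1$, $u_{m+1}=u_ms_{i_{m+1}}$ if $\ell(u_ms_{i_{m+1}})>\ell(u_m)$ and $u_{m+1}=u_m$ otherwise). It is known that $z_m$ converges almost surely to a limit $\zeta\in\overline{\mathbb{R}}$. *)

(* Defs.v *)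
From HB Require Import structures.
From mathcomp Require Import all_boot all_order all_algebra.
From mathcomp Require Import all_classical all_reals all_analysis.
Set Implicit Arguments. Unset Strict Implicit. Unset Printing Implicit Defensive.
Import Order.TTheory GRing.Theory Num.Theory.
Local Open Scope classical_set_scope.
Local Open Scope ring_scope.

Section Geom.
Variable R : realType.

(* A hyperbolic line in the upper half-plane:
   [Vert x]   = { z in H : Re z = x },
   [Circ x r] = { z in H : |z - x| = r }  (requires 0 < r). *)
Inductive hline := Vert of R | Circ of R & R.

Definition valid_line (L : hline) : Prop :=
  match L with Vert _ => True | Circ _ r => 0 < r end.

(* Points of the closed disk Hbar = H u R u {oo}:
   [Some (a, b)] is a + i b (with b >= 0), [None] is oo.
   Points of Rbar = R u {oo}: [Some x] is x, [None] is oo. *)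
Definition cpt := option (R * R).
Definition rbar := option R.
Definition emb (x : rbar) : cpt :=
  match x with Some a => Some (a, 0) | None => None end.
Definition proj (z : cpt) : rbar :=
  match z with Some (a, _) => Some a | None => None end.

Definition inH (p : R * R) : Prop := 0 < p.2.

(* defining function of the line: the line is its zero set in H,
   its two sides are where it is positive / negative *)
Definition lfun (L : hline) (p : R * R) : R :=
  match L with
  | Vert x => p.1 - x
  | Circ x r => (p.1 - x) ^+ 2 + p.2 ^+ 2 - r ^+ 2
  end.

Definition on_line (L : hline) (p : R * R) : Prop := inH p /\ lfun L p = 0.

Definition lgrad (L : hline) (p : R * R) : R * R :=
  match L with
  | Vert _ => (1, 0)
  | Circ x _ => (2 * (p.1 - x), 2 * p.2)
  end.

Definition dot (u v : R * R) : R := u.1 * v.1 + u.2 * v.2.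
Definition vnorm (u : R * R) : R := Num.sqrt (dot u u).

(* reflection t_L, extended continuously to the closed disk *)
Definition refl (L : hline) (z : cpt) : cpt :=
  match L, z with
  | Vert x, Some (a, b) => Some (2 * x - a, b)
  | Vert _, None => None
  | Circ x r, Some (a, b) =>
      let d := (a - x) ^+ 2 + b ^+ 2 in
      if d == 0 then None
      else Some (x + r ^+ 2 * (a - x) / d, r ^+ 2 * b / d)
  | Circ x _, None => Some (x, 0)
  end.

Definition sameside (L : hline) (z0 : R * R) (z : cpt) : bool :=
  match z with
  | Some p => 0 < lfun L p * lfun L z0
  | None => match L with Vert _ => false | Circ _ _ => 0 < lfun L z0 end
  end.

Definition oneway (L : hline) (z0 : R * R) (z : cpt) : cpt :=
  if sameside L z0 z then refl L z else z.

Definition oneway_bd (L : hline) (z0 : R * R) (x : rbar) : rbar :=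
  proj (oneway L z0 (emb x)).

(* Standing hypothesis on a pair of lines (L1, L2) and the base point z0:
   z0 is off both lines, and either
   (a) the lines are disjoint in H and z0 lies in the component of
       H \ (L1 u L2) whose boundary contains both lines, i.e. z0 is on the
       side of L1 containing L2 and on the side of L2 containing L1; or
   (b) the lines meet at a point p of H, and the angle at p of the sector
       containing z0 (the intersection of the sides of L1, L2 containing z0)
       is pi/m for an integer m >= 2.  With inward normals
       n_i = sg(lfun L_i z0) * grad(lfun L_i)(p), this angle alpha satisfies
       n1 . n2 = - cos(alpha) |n1| |n2|. *)
Definition pair_ok (L1 L2 : hline) (z0 : R * R) : Prop :=
  lfun L1 z0 != 0 /\ lfun L2 z0 != 0 /\
  ( ( (forall p, ~ (on_line L1 p /\ on_line L2 p)) /\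
      (forall p, on_line L2 p -> 0 < lfun L1 p * lfun L1 z0) /\
      (forall p, on_line L1 p -> 0 < lfun L2 p * lfun L2 z0) )
  \/ (exists (m : nat) (p : R * R), (2 <= m)%N /\
        on_line L1 p /\ on_line L2 p /\
        Num.sg (lfun L1 z0) * Num.sg (lfun L2 z0) * dot (lgrad L1 p) (lgrad L2 p)
          = - cos (pi / m%:R) * vnorm (lgrad L1 p) * vnorm (lgrad L2 p)) ).

Definition conv_to (z : nat -> cpt) (l : rbar) : Prop :=
  match l with
  | Some x => forall e : R, 0 < e -> exists N, forall m, (N <= m)%N ->
      exists a b, z m = Some (a, b) /\ (a - x) ^+ 2 + b ^+ 2 < e
  | None => forall M : R, exists N, forall m, (N <= m)%N ->
      match z m with Some (a, b) => M < a ^+ 2 + b ^+ 2 | None => true end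
  end.

(* Borel sets of Rbar (one-point compactification of R): A is Borel iff its
   trace on R is Borel *)
Definition rbar_borel (A : set rbar) : Prop :=
  measurable [set x : R | A (Some x)].

End Geom.

(* z_m = (tau_{i_1} o ... o tau_{i_m})(z0), indices given by ii 0, ii 1, ... *)
Definition walk (R : realType) (L : 'I_3 -> hline R) (z0 : R * R)
  (ii : nat -> 'I_3) (m : nat) : cpt R :=
  foldr (fun k acc => oneway (L (ii k)) z0 acc) (Some z0) (iota 0 m).

Definition iid_uniform3 (R : realType) (d : measure_display) (T : measurableType d)
  (P : probability T R) (ii : nat -> T -> 'I_3) : Prop :=
  (forall k (j : 'I_3), measurable (ii k @^-1` [set j])) /\
  (forall (s : seq nat) (j : nat -> 'I_3), uniq s ->
     P (\bigcap_(k in [set` s]) (ii k @^-1` [set j k]))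
       = ((3%:R)^-1 ^+ size s)%:E).

(* Main.v *)
Require Import Defs.
From HB Require Import structures.
From mathcomp Require Import all_boot all_order all_algebra.
From mathcomp Require Import all_classical all_reals all_analysis.
From mathcomp Require Import measurable_realfun ring lra.
Import Order.TTheory GRing.Theory Num.Theory.
Import numFieldNormedType.Exports.
Local Open Scope classical_set_scope.
Local Open Scope ring_scope.

(** Let [zeta'] be the limit of the walk driven by the shifted indices
    i_2, i_3, ...  One-way reflections extend continuously to the boundary, so
    [zeta = tau_{i_1}(zeta')] wherever [zeta'] exists.  The shifted index
    sequence is independent of i_1 and has the law of the original one;
    conditioning on i_1 therefore gives the stationarity equation.

    As [zeta] is only given up to a null set, [zeta'] is never built: every
    event about a limit is replaced by the event
    "the walk converges to a point of A", which is measurable for the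
    sigma-algebra generated by finite prefixes of the index sequence and hence
    can be transported along the shift. *)

(* Junk value [0] at infinity. *)
Definition re {R : realType} (z : cpt R) : R := if z is Some p then p.1 else 0.
Definition im {R : realType} (z : cpt R) : R := if z is Some p then p.2 else 0.

Lemma ltr_norm_sqr {R : realType} (u e : R) :
  0 < e -> u ^+ 2 < e ^+ 2 -> `|u| < e.
Proof. by move=> e0 ue; rewrite ltr_norml; apply/andP; split; nra. Qed.

Lemma cvg_sqr {R : realType} (f : nat -> R) (x : R) :
  f m @[m --> \oo] --> x -> f m ^+ 2 @[m --> \oo] --> x ^+ 2.
Proof. by move=> fx; rewrite expr2; under eq_fun do rewrite expr2; exact: cvgM. Qed.

Lemma cvg_near_eq {R : realType} (f g : nat -> R) (x : R) :
  (\forall m \near \oo, f m = g m) -> g m @[m --> \oo] --> x ->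
  f m @[m --> \oo] --> x.
Proof.
move=> fg gx; apply: cvg_trans gx; apply: near_eq_cvg.
by apply: filterS fg => m ->.
Qed.

(** * Convergence to boundary points and continuity of one-way reflections *)

Section Convergence.
Context {R : realType}.
Implicit Types (z : nat -> cpt R) (l : rbar R).

(** Splitting into coordinates makes the algebra of real limits available for the formulas of
    reflections. *)
Lemma conv_to_SomeP z (x : R) :
  conv_to z (Some x) <->
  [/\ \forall m \near \oo, z m <> None,
      re (z m) @[m --> \oo] --> x & im (z m) @[m --> \oo] --> (0 : R)].
Proof.
split=> [zx|[zfin rex im0] e e0].
  split.
  - have [N hN] := zx 1 ltr01.
    by exists N => // m /= /hN[a [b [-> _]]].
  - apply/cvgrPdist_lt => e e0; have [N hN] := zx _ (exprn_gt0 2 e0).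
    exists N => // m /= /hN[a [b [-> ab]]] /=.
    rewrite distrC; apply: ltr_norm_sqr => //.
    by apply: le_lt_trans ab; rewrite lerDl sqr_ge0.
  - apply/cvgrPdist_lt => e e0; have [N hN] := zx _ (exprn_gt0 2 e0).
    exists N => // m /= /hN[a [b [-> ab]]] /=.
    rewrite sub0r normrN; apply: ltr_norm_sqr => //.
    by apply: le_lt_trans ab; rewrite lerDr sqr_ge0.
have : (re (z m) - x) ^+ 2 + im (z m) ^+ 2 @[m --> \oo] --> (x - x) ^+ 2 + 0 ^+ 2.
  by apply: cvgD; apply: cvg_sqr => //; apply: cvgB => //; exact: cvg_cst.
rewrite subrr expr0n addr0 => /cvgrPdist_lt/(_ e e0) near0.
have [N _ hN] : \forall m \near \oo, z m <> None /\
    `|0 - ((re (z m) - x) ^+ 2 + im (z m) ^+ 2)| < e.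
  by apply: filterS2 zfin near0.
exists N => m /hN[]; case: (z m) => //= -[a b] _ /=.
rewrite sub0r normrN ger0_norm ?addr_ge0 ?sqr_ge0// => ab.
by exists a, b.
Qed.

Lemma conv_to_NoneP z :
  conv_to z None <->
  (forall M : R, \forall m \near \oo,
     z m <> None -> M < re (z m) ^+ 2 + im (z m) ^+ 2).
Proof.
split=> h M; [have [N hN] := h M|have [N _ hN] := h M].
  by exists N => // m /= /hN; case: (z m) => [[a b]|].
by exists N => m /hN; case: (z m) => [[a b]|] //=; apply.
Qed.

Lemma conv_to_unique z l l' : conv_to z l -> conv_to z l' -> l = l'.
Proof.
(* A finite limit keeps the squared modulus eventually bounded, which excludes convergence to
   infinity. *)
have some_none x : conv_to z (Some x) -> conv_to z None -> False.
  move=> /conv_to_SomeP[zfin rex im0] /conv_to_NoneP zoo.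
  have zc : re (z m) ^+ 2 + im (z m) ^+ 2 @[m --> \oo] --> x ^+ 2 + 0 ^+ 2.
    by apply: cvgD; exact: cvg_sqr.
  have /cvgr_lt/(_ (x ^+ 2 + 0 ^+ 2 + 1)) := zc.
  rewrite ltrDl ltr01 => /(_ isT) zlt.
  have [N _ /(_ N (leqnn N))] : \forall m \near \oo, False => //.
  apply: (filterS3 _ _ zfin (zoo (x ^+ 2 + 0 ^+ 2 + 1)) zlt) => m zm.
  by move=> /(_ zm) h1 h2; have := lt_trans h1 h2; rewrite ltxx.
case: l => [x|]; case: l' => [y|] //.
- move=> /conv_to_SomeP[_ hx _] /conv_to_SomeP[_ hy _]; congr Some.
  exact: (cvg_unique _ hx hy).
- by move=> zx zoo; case: (some_none _ zx zoo).
- by move=> zoo zx; case: (some_none _ zx zoo).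
Qed.

(** Serves at an end of a line, where a sequence may change sides infinitely often and [u]
    alternates between reflected and unreflected points. *)
Lemma conv_to_merge z z' u l : conv_to z l -> conv_to z' l ->
  (\forall m \near \oo, u m = z m \/ u m = z' m) -> conv_to u l.
Proof.
move=> zl z'l [N0 _ hu]; case: l zl z'l => [x|] zl z'l e.
  move=> e0; have [N1 h1] := zl e e0; have [N2 h2] := z'l e e0.
  exists (maxn N0 (maxn N1 N2)) => m; rewrite !geq_max => /and3P[m0 m1 m2].
  by case: (hu m m0) => ->; [exact: h1|exact: h2].
have [N1 h1] := zl e; have [N2 h2] := z'l e.
exists (maxn N0 (maxn N1 N2)) => m; rewrite !geq_max => /and3P[m0 m1 m2].
by case: (hu m m0) => ->; [exact: h1|exact: h2].
Qed.

Lemma conv_to_near_eq z u l : conv_to z l ->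
  (\forall m \near \oo, u m = z m) -> conv_to u l.
Proof.
move=> zl uz; apply: (conv_to_merge _ _ _ _ zl zl).
by apply: filterS uz => m; left.
Qed.

Lemma lfun_cvg (L : hline R) z (x : R) : conv_to z (Some x) ->
  lfun L (re (z m), im (z m)) @[m --> \oo] --> lfun L (x, 0).
Proof.
move=> /conv_to_SomeP[_ hr hi]; case: L => [c|c r] /=.
  by apply: cvgB => //; exact: cvg_cst.
apply: cvgB; last exact: cvg_cst.
by apply: cvgD; apply: cvg_sqr => //; apply: cvgB => //; exact: cvg_cst.
Qed.

(** This is [|z|^2 <= 2 |z - x|^2 + 2 x^2]; the difference of the two sides is
    [(a - 2x)^2 + b^2]. *)
Lemma sqr_dist_gt (a b x M : R) : 2 * M + 2 * x ^+ 2 < a ^+ 2 + b ^+ 2 ->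
  M < (a - x) ^+ 2 + b ^+ 2.
Proof. by move=> h; have := sqr_ge0 (a - 2 * x); have := sqr_ge0 b; nra. Qed.

(** Inversion turns the distance [rho] from the centre into [r^2 / rho]; here both are squared. *)
Lemma sqr_norm_inversion (c r a b : R) : (a - c) ^+ 2 + b ^+ 2 != 0 ->
  (r ^+ 2 * (a - c) / ((a - c) ^+ 2 + b ^+ 2)) ^+ 2 +
  (r ^+ 2 * b / ((a - c) ^+ 2 + b ^+ 2)) ^+ 2 =
  r ^+ 4 / ((a - c) ^+ 2 + b ^+ 2).
Proof. by move=> h; field. Qed.

(** Inversion exchanges the centre and infinity, so these two limits are estimated by hand; at every
    other boundary point the formula is a continuous quotient. *)
Lemma conv_to_refl (L : hline R) z l : valid_line L -> conv_to z l ->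
  conv_to (fun m => refl L (z m)) (Defs.proj (refl L (emb l))).
Proof.
case: L => [c _|c r /= r0].
  case: l => [x|] /=.
    move=> /conv_to_SomeP[zfin hr hi]; apply/conv_to_SomeP; split.
    - by apply: filterS zfin => m; case: (z m) => [[a b]|].
    - apply: (cvg_near_eq _ (fun m => 2 * c - re (z m))).
        by apply: filterS zfin => m; case: (z m) => [[a b]|].
      by apply: cvgB => //; exact: cvg_cst.
    - apply: (cvg_near_eq _ (fun m => im (z m))) => //.
      by apply: filterS zfin => m; case: (z m) => [[a b]|].
  move=> /conv_to_NoneP h; apply/conv_to_NoneP => M.
  have := h (2 * M + 2 * (2 * c) ^+ 2).
  apply: filterS => m; case: (z m) => [[a b]|] //= h1 _.
  by rewrite -sqrrN opprB; exact/sqr_dist_gt/h1.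
have r4 : 0 < r ^+ 4 by exact: exprn_gt0.
case: l => [x|] /=; last first.
  (* Beyond this bound [sqr_dist_gt] puts the squared distance from [c] above [r^4 / e], so the
     image is within squared distance [e] of [c]. *)
  move=> zoo e e0; have [N hN] := zoo (2 * (r ^+ 4 / e) + 2 * c ^+ 2).
  exists N => m /hN; case: (z m) => [[a b]|] /=; last first.
    by move=> _; exists c, 0; rewrite subrr expr0n addr0.
  move=> /sqr_dist_gt; set d := (_ + b ^+ 2) => hd.
  have d0 : 0 < d by apply: lt_trans hd; rewrite divr_gt0.
  rewrite gt_eqF//; eexists; eexists; split; first by [].
  rewrite [c + _]addrC addrK sqr_norm_inversion ?gt_eqF//.
  by rewrite ltr_pdivrMr// mulrC -ltr_pdivrMr.
rewrite expr0n addr0 sqrf_eq0 subr_eq0.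
have [->{x}|xc] := eqVneq x c => zx.
  move=> M.
  (* The bound asked for by [sqr_dist_gt], with [M] replaced by [|M| + 1] so that [K] is positive
     and [r^4 / K] is a legitimate radius. *)
  pose K := 2 * (`|M| + 1) + 2 * c ^+ 2.
  have K0 : 0 < K by rewrite /K; have := normr_ge0 M; have := sqr_ge0 c; nra.
  have [N hN] := zx (r ^+ 4 / K) (divr_gt0 r4 K0).
  exists N => m /hN[a [b [-> /=]]]; set d := (_ + b ^+ 2) => hd.
  case: ifPn => // dn0.
  have d0 : 0 < d by rewrite lt_def dn0 addr_ge0 ?sqr_ge0.
  have := sqr_norm_inversion c r a b dn0; rewrite -/d.
  set u := _ / d; set v := _ / d => uv.
  have : K < u ^+ 2 + v ^+ 2.
    by rewrite uv ltr_pdivlMr// mulrC -ltr_pdivlMr.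
  have -> : c + u = u - - c by rewrite opprK addrC.
  move=> Kuv; apply: sqr_dist_gt; rewrite sqrrN.
  by apply: le_lt_trans Kuv; rewrite /K; have := ler_norm M; nra.
have [zfin hr hi] := (conv_to_SomeP _ _).1 zx.
have dx : (x - c) ^+ 2 + 0 ^+ 2 != 0.
  by rewrite expr0n addr0 sqrf_eq0 subr_eq0.
have hd : (re (z m) - c) ^+ 2 + im (z m) ^+ 2 @[m --> \oo] -->
    (x - c) ^+ 2 + 0 ^+ 2.
  by apply: cvgD; apply: cvg_sqr => //; apply: cvgB => //; exact: cvg_cst.
have hdn0 : \forall m \near \oo, (re (z m) - c) ^+ 2 + im (z m) ^+ 2 != 0.
  exact: cvgr_neq0 hd dx.
have near_refl : \forall m \near \oo, refl (Circ c r) (z m) =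
    Some (c + r ^+ 2 * (re (z m) - c) / ((re (z m) - c) ^+ 2 + im (z m) ^+ 2),
      r ^+ 2 * im (z m) / ((re (z m) - c) ^+ 2 + im (z m) ^+ 2)).
  apply: filterS2 zfin hdn0 => m.
  by case: (z m) => //= -[a b] _ /= /negbTE ->.
move: near_refl => /= near_refl; apply/conv_to_SomeP; split => /=.
- by apply: filterS near_refl => m ->.
- have -> : (x - c) ^+ 2 = (x - c) ^+ 2 + 0 ^+ 2 :> R by rewrite expr0n addr0.
  apply: (cvg_near_eq _ (fun m => c + r ^+ 2 * (re (z m) - c) /
      ((re (z m) - c) ^+ 2 + im (z m) ^+ 2))).
    by apply: filterS near_refl => m ->.
  apply: cvgD; first exact: cvg_cst.
  apply: cvgM; last exact: cvgV.
  by apply: cvgM; [exact: cvg_cst|apply: cvgB => //; exact: cvg_cst].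
- apply: (cvg_near_eq _ (fun m => r ^+ 2 * im (z m) /
      ((re (z m) - c) ^+ 2 + im (z m) ^+ 2))).
    by apply: filterS near_refl => m ->.
  have : r ^+ 2 * im (z m) / ((re (z m) - c) ^+ 2 + im (z m) ^+ 2)
      @[m --> \oo] --> r ^+ 2 * 0 / ((x - c) ^+ 2 + 0 ^+ 2).
    apply: cvgM; last exact: cvgV.
    by apply: cvgM => //; exact: cvg_cst.
  by rewrite mulr0 mul0r.
Qed.

(* A boundary point where [sameside] is not locally constant is an end of the
   line, hence fixed by the reflection. *)
Lemma sameside_near (L : hline R) (z0 : R * R) z l : valid_line L ->
  conv_to z l ->
  (\forall m \near \oo, sameside L z0 (z m) = sameside L z0 (emb l)) \/
  refl L (emb l) = emb l.
Proof.
move=> vL; case: l => [x|] zl.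
  have [zfin _ _] := (conv_to_SomeP _ _).1 zl.
  have hl : lfun L (re (z m), im (z m)) * lfun L z0 @[m --> \oo] -->
      lfun L (x, 0) * lfun L z0.
    by apply: cvgM; [exact: lfun_cvg|exact: cvg_cst].
  have zlE : \forall m \near \oo, sameside L z0 (z m) =
      (0 < lfun L (re (z m), im (z m)) * lfun L z0).
    by apply: filterS zfin => m; case: (z m) => //= -[a b].
  have [lz0|lz0] := eqVneq (lfun L z0) 0.
    left; apply: filterS zlE => m ->.
    by rewrite /= lz0 !mulr0.
  have [lx|lx] := eqVneq (lfun L (x, 0)) 0.
    right; case: L vL lx {hl zlE lz0} => [c|c r] /=.
      by move=> _ /eqP; rewrite subr_eq0 => /eqP ->; do 2 f_equal; ring.
    move=> r0 /eqP; rewrite subr_eq0 => /eqP ->.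
    rewrite sqrf_eq0 gt_eqF// mulr0 mul0r.
    by rewrite mulrAC divff ?sqrf_eq0 ?gt_eqF// mul1r addrC subrK.
  left; have : lfun L (x, 0) * lfun L z0 != 0 by rewrite mulf_neq0.
  rewrite neq_lt => /orP[neg|pos].
    apply: filterS2 zlE (cvgr_lt _ hl _ neg) => m -> ml /=.
    by rewrite !ltNge (ltW ml) (ltW neg).
  apply: filterS2 zlE (cvgr_gt _ hl _ pos) => m -> ml /=.
  by rewrite pos ml.
case: L vL => [c|c r] r0; first by right.
(* Points this far out lie outside the circle, where [lfun] is positive, in agreement with the value
   of [sameside] at infinity. *)
left; have := (conv_to_NoneP _).1 zl (2 * r ^+ 2 + 2 * c ^+ 2).
apply: filterS => m; case: (z m) => [[a b]|] //= /(_ ltac:(done)).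
move=> /sqr_dist_gt; rewrite -subr_gt0 => d0.
by rewrite pmulr_rgt0.
Qed.

Lemma projK (l : rbar R) : Defs.proj (emb l) = l.
Proof. by case: l. Qed.

(** Either the side is eventually constant, and the map is eventually the reflection or the
    identity, or [l] is fixed by the reflection, and both branches converge to [l]. *)
Lemma conv_to_oneway (L : hline R) (z0 : R * R) z l : valid_line L ->
  conv_to z l -> conv_to (fun m => oneway L z0 (z m)) (oneway_bd L z0 l).
Proof.
move=> vL zl; have zr := conv_to_refl _ _ _ vL zl.
have [near_side|fixl] := sameside_near L z0 z l vL zl; rewrite /oneway_bd.
  rewrite {2}/oneway; case: ifPn near_side => [_|/negbTE _] near_side.
    apply: conv_to_near_eq zr _.
    by apply: filterS near_side => m; rewrite /oneway => ->.
  rewrite projK; apply: conv_to_near_eq zl _.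
  by apply: filterS near_side => m; rewrite /oneway => ->.
have -> : oneway L z0 (emb l) = emb l by rewrite /oneway fixl if_same.
rewrite projK; rewrite fixl projK in zr; apply: (conv_to_merge _ _ _ _ zl zr).
by near=> m; rewrite /oneway; case: ifP; [right|left].
Unshelve. all: by end_near. Qed.

End Convergence.

(** * First-step recursion of the walk *)

Lemma walkS (R : realType) (L : 'I_3 -> hline R) (z0 : R * R)
    (j : nat -> 'I_3) m :
  walk L z0 j m.+1 = oneway (L (j 0)) z0 (walk L z0 (fun k => j k.+1) m).
Proof.
by rewrite /walk /= -[1%N]/(1 + 0)%N iotaDl foldr_map.
Qed.

(** The first index acts outermost, so removing it leaves the walk of the shifted indices;
    continuity then carries the limit through, path by path. *)
Lemma conv_to_walkS (R : realType) (L : 'I_3 -> hline R) (z0 : R * R)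
    (j : nat -> 'I_3) l : (forall i, valid_line (L i)) ->
  conv_to (walk L z0 (fun k => j k.+1)) l ->
  conv_to (walk L z0 j) (oneway_bd (L (j 0)) z0 l).
Proof.
move=> vL /(conv_to_oneway (L (j 0)) z0 _ _ (vL _)).
case: (oneway_bd _ _ _) => [x|] h e.
  move=> e0; have [N hN] := h e e0.
  (* Time [m] of the shifted walk is time [m.+1] of the original one. *)
  by exists N.+1 => -[//|m] /hN; rewrite walkS.
have [N hN] := h e.
by exists N.+1 => -[//|m] /hN; rewrite walkS.
Qed.

(** * Borel measurability of one-way reflections on the boundary *)

Section BoundaryMeasurability.
Context {R : realType}.

(** The inverse is continuous on the open set of nonzero reals; the conventional value at [0] is
    treated separately. *)
Lemma measurable_inv : measurable_fun [set: R] (@GRing.inv R).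
Proof.
rewrite (_ : @GRing.inv R = fun x => if x == 0 then 0 else x^-1); last first.
  by apply/funext => x; case: eqVneq => [->|]; rewrite ?invr0.
apply: measurable_fun_if => //.
- by apply: measurable_fun_eqr => //; exact: measurable_cst.
- apply: (@measurable_funS _ _ R R (~` [set (0 : R)])).
  + by apply: measurableC; exact: measurable_set1.
  + by move=> x /= [_ /negbT/eqP].
  + apply: open_continuous_measurable_fun.
      by apply: closed_openC; exact: closed_eq.
    by move=> x; rewrite inE /= => /eqP x0; exact: inv_continuous.
Qed.

(** Borel sets are tested by their traces on the real line, so it suffices to describe [f] there;
    [E] marks the real points sent to infinity. *)
Lemma rbar_borel_preimage (f : rbar R -> rbar R) (E : R -> bool) (h : R -> R)
    (A : set (rbar R)) :
  measurable_fun setT E -> measurable_fun setT h ->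
  (forall a, f (Some a) = if E a then None else Some (h a)) ->
  rbar_borel A -> rbar_borel (f @^-1` A).
Proof.
move=> mE mh fE mA; rewrite /rbar_borel.
have mET : measurable [set a | E a].
  by rewrite -[X in measurable X]setTI; exact: mE.
have mhA : measurable (h @^-1` [set x | A (Some x)]).
  by rewrite -[X in measurable X]setTI; exact: mh.
have -> : [set x | (f @^-1` A) (Some x)] =
    ([set a | E a] `&` [set _ | A None]) `|`
    (~` [set a | E a] `&` h @^-1` [set x | A (Some x)]).
  apply/seteqP; split=> a /=; rewrite fE; case: (E a); first by left.
  - by right.
  - by case=> -[].
  - by case=> -[].
apply: measurableU; apply: measurableI => //; last exact: measurableC.
have [AN|AN] := pselect (A None).
  by rewrite (_ : [set _ | _] = setT)//; apply/seteqP; split.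
by rewrite (_ : [set _ | _] = set0)//; apply/seteqP; split.
Qed.

Lemma rbar_borel_oneway (L : hline R) (z0 : R * R) (A : set (rbar R)) :
  rbar_borel A -> rbar_borel (oneway_bd L z0 @^-1` A).
Proof.
have mid : measurable_fun [set: R] (fun a : R => a) by exact: measurable_id.
have mc (c : R) : measurable_fun [set: R] (fun _ : R => c).
  exact: measurable_cst.
have mB (c : R) : measurable_fun [set: R] (fun a => a - c).
  exact: measurable_funB.
have mS (c k : R) : measurable_fun [set: R] (fun a => (a - c) ^+ 2 + k).
  by apply: measurable_funD => //; exact: measurable_funX.
case: L => [c|c r]; rewrite /oneway_bd /oneway /=.
  apply: (@rbar_borel_preimage _ (fun _ => false)
    (fun a => if 0 < (a - c) * lfun (Vert c) z0 then 2 * c - a else a)) => //.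
  - apply: measurable_fun_ifT => //; last exact: measurable_funB.
    by apply: measurable_fun_ltr => //; exact: measurable_funM.
  - by move=> a /=; case: ifP.
have ms : measurable_fun setT (fun a : R =>
    0 < ((a - c) ^+ 2 + 0 ^+ 2 - r ^+ 2) * lfun (Circ c r) z0).
  apply: measurable_fun_ltr => //; apply: measurable_funM => //.
  exact: measurable_funB.
(* The only real point that can go to infinity is the centre, and it does so exactly when it lies on
   the side of [z0]. *)
apply: (@rbar_borel_preimage _
  (fun a => (0 < ((a - c) ^+ 2 + 0 ^+ 2 - r ^+ 2) * lfun (Circ c r) z0) &&
     ((a - c) ^+ 2 + 0 ^+ 2 == 0))
  (fun a => if 0 < ((a - c) ^+ 2 + 0 ^+ 2 - r ^+ 2) * lfun (Circ c r) z0
     then c + r ^+ 2 * (a - c) / ((a - c) ^+ 2 + 0 ^+ 2) else a)).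
- by apply: measurable_and => //; exact: measurable_fun_eqr.
- apply: measurable_fun_ifT => //; apply: measurable_funD => //.
  apply: measurable_funM; first exact: measurable_funM.
  by apply: (measurableT_comp measurable_inv); exact: mS.
- by move=> a /=; case: ifP => //= _; case: ifP.
Qed.

End BoundaryMeasurability.

(** * Measurability of events about limits *)

Section LimitEvent.
Context {R : realType} {d : measure_display} {T : measurableType d}.
Variable z : nat -> T -> cpt R.
Hypothesis mz : forall m (S : set (cpt R)), measurable (z m @^-1` S).

Let meas_all (m : nat) (h : cpt R -> R) : measurable_fun setT (h \o z m).
Proof. by move=> _ B _; rewrite setTI; exact: (mz m (h @^-1` B)). Qed.

(** The target varies with [w] so that a random candidate limit can be inserted. Radii [1/(k+1)]
    reduce the definition of convergence to countable set operations. *)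
Lemma measurable_conv_to_Some (f : T -> R) : measurable_fun setT f ->
  measurable [set w | conv_to (z ^~ w) (Some (f w))].
Proof.
move=> mf.
rewrite (_ : [set w | _] = \bigcap_k \bigcup_N \bigcap_(m in [set m | (N <= m)%N])
    (z m @^-1` (~` [set None]) `&`
     [set w | (re (z m w) - f w) ^+ 2 + im (z m w) ^+ 2 < k.+1%:R^-1])).
  apply: bigcapT_measurable => k; apply: bigcup_measurable => N _.
  apply: bigcap_measurable => [|m _]; first by exists N => /=.
  apply: measurableI; first exact: mz.
  have ml : measurable_fun setT (fun w =>
      (re (z m w) - f w) ^+ 2 + im (z m w) ^+ 2 < k.+1%:R^-1).
    apply: measurable_fun_ltr; last exact: measurable_cst.
    apply: measurable_funD; apply: measurable_funX; last exact: (meas_all m im).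
    by apply: measurable_funB => //; exact: (meas_all m re).
  by rewrite -[X in measurable X]setTI; exact: (ml measurableT [set true]).
apply/seteqP; split=> w /=.
  move=> zw k _; have [N hN] := zw k.+1%:R^-1 ltac:(by rewrite invr_gt0).
  exists N => // m /= /hN[a [b [zm ab]]]; split; rewrite /= zm //.
move=> zw e e0.
have [k ke] : exists k, k.+1%:R^-1 < e.
  have [k _ /(_ k (leqnn k)) /= ke] := near_infty_natSinv_lt (PosNum e0).
  by exists k.
have [N _ hN] := zw k I; exists N => m /hN[]/=.
case: (z m w) => //= -[a b] _ /= ab; exists a, b; split=> //.
exact: lt_trans ab ke.
Qed.

Lemma measurable_conv_to_None : measurable [set w | conv_to (z ^~ w) None].
Proof.
rewrite (_ : [set w | _] = \bigcap_k \bigcup_N \bigcap_(m in [set m | (N <= m)%N])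
    (z m @^-1` [set p | p <> None -> k%:R < re p ^+ 2 + im p ^+ 2])).
  apply: bigcapT_measurable => k; apply: bigcup_measurable => N _.
  by apply: bigcap_measurable => [|m _]; [exists N => /=|exact: mz].
apply/seteqP; split=> w /=.
  move=> zw k _; have [N hN] := zw k%:R.
  by exists N => // m /= /hN; case: (z m w) => [[a b]|].
move=> zw M; have [N _ hN] := zw (Num.truncn `|M|).+1 I.
exists N => m /hN /=; case: (z m w) => [[a b]|] //= /(_ ltac:(done)).
apply: lt_trans; apply: le_lt_trans (ler_norm M) _.
exact: truncnS_gt.
Qed.

(** The existential ranges over uncountably many limits, but a finite one must equal the upper limit
    of the real parts, a measurable function. Only this candidate and infinity have to be tested. *)
Lemma measurable_limit_event (A : set (rbar R)) : rbar_borel A ->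
  measurable [set w | exists2 l, conv_to (z ^~ w) l & A l].
Proof.
move=> mA.
(* An infinite upper limit becomes [0] under [fine]; this is harmless, since convergence to [f w] is
   tested afterwards. *)
pose f w := fine (limn_esup (fun m => (re (z m w))%:E)).
have mf : measurable_fun setT f.
  have mfine : measurable_fun setT (@fine R) by exact: fine_measurable.
  apply: (measurableT_comp mfine).
  apply: measurable_fun_limn_esup => m.
  by apply/measurable_EFinP; exact: (meas_all m re).
have fE w x : conv_to (z ^~ w) (Some x) -> f w = x.
  move=> /conv_to_SomeP[_ zx _].
  have /cvg_limn_einf_sup[_ fx] : (re (z m w))%:E @[m --> \oo] --> x%:E.
    by apply: cvg_EFin => //; exact: nearW.
  by rewrite /f fx.
rewrite (_ : [set w | _] =
   ([set w | conv_to (z ^~ w) None] `&` [set _ | A None]) `|`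
   ([set w | conv_to (z ^~ w) (Some (f w))] `&`
      f @^-1` [set x | A (Some x)])).
  apply: measurableU; apply: measurableI.
  - exact: measurable_conv_to_None.
  - have [AN|AN] := pselect (A None).
      by rewrite (_ : [set _ | _] = setT)//; apply/seteqP; split.
    by rewrite (_ : [set _ | _] = set0)//; apply/seteqP; split.
  - exact: measurable_conv_to_Some.
  - by rewrite -[X in measurable X]setTI; exact: mf.
apply/seteqP; split=> w /=.
  move=> [[x|] zx Ax]; last by left.
  by right; rewrite (fE _ _ zx).
by move=> [[zw Aw]|[zw Aw]]; [exists None|exists (Some (f w))].
Qed.

End LimitEvent.

(** * The space of index sequences *)

HB.instance Definition _ (n : nat) := isPointed.Build 'I_n.+1 ord0.

Definition prefix_cylinder (n : nat) (c : nat -> 'I_3) : set (nat -> 'I_3) :=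
  [set j | forall k, (k < n)%N -> j k = c k].

(** The empty set is included to make the family closed under intersection: two cylinders are either
    nested or disjoint. *)
Definition prefix_cylinders : set (set (nat -> 'I_3)) :=
  [set B | B = set0 \/ exists n c, B = prefix_cylinder n c].

Definition path_space := g_sigma_algebraType prefix_cylinders.

Lemma setI_closed_prefix_cylinders : setI_closed prefix_cylinders.
Proof.
move=> B C [->|[n [c ->]]]; first by rewrite set0I; left.
case=> [->|[m [e ->]]]; first by rewrite setI0; left.
wlog nm : n m c e / (n <= m)%N => [H|].
  by have [/H//|/ltnW/H] := leqP n m; rewrite setIC; exact.
have [ce|ce] := pselect (forall k, (k < n)%N -> c k = e k); last first.
  left; apply/seteqP; split=> // j [jc je]; apply: ce => k kn.
  by rewrite -jc// je//; exact: leq_trans nm.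
right; exists m, e; apply/seteqP; split=> j; first by case.
by move=> je; split=> // k kn; rewrite ce// je//; exact: leq_trans nm.
Qed.

Lemma measurable_prefix_cylinder n c :
  measurable (prefix_cylinder n c : set path_space).
Proof. by apply: sub_sigma_algebra; right; exists n, c. Qed.

(** A finite alphabet has finitely many prefixes of length [n], so [B] is a finite union of
    cylinders. *)
Lemma measurable_prefix_dependent n (B : set path_space) :
  (forall i j : nat -> 'I_3, (forall k, (k < n)%N -> i k = j k) -> B i -> B j) ->
  measurable B.
Proof.
move=> Bn.
(* Pads a prefix to an infinite sequence; membership in [B] is insensitive to the padding. *)
pose ext (f : {ffun 'I_n -> 'I_3}) k : 'I_3 :=
  if insub k is Some i then f i else ord0.
rewrite (_ : B = \bigcup_(f in [set f | B (ext f)]) prefix_cylinder n (ext f)).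
  apply: fin_bigcup_measurable => // f _; exact: measurable_prefix_cylinder.
apply/seteqP; split=> [j Bj|j [f /= Bf jf]]; last first.
  by apply: Bn Bf => k kn; rewrite jf.
have jE k : (k < n)%N -> j k = ext [ffun i : 'I_n => j i] k.
  by move=> kn; rewrite /ext insubT ffunE.
by exists [ffun i : 'I_n => j i] => //=; exact: Bn Bj.
Qed.

Lemma walk_prefix (R : realType) (L : 'I_3 -> hline R) (z0 : R * R) m
    (i j : nat -> 'I_3) : (forall k, (k < m)%N -> i k = j k) ->
  walk L z0 i m = walk L z0 j m.
Proof.
elim: m i j => [//|m IH] i j ij; rewrite !walkS ij//; congr oneway.
by apply: IH => k km; exact: ij.
Qed.

Lemma measurable_walk_limit (R : realType) (L : 'I_3 -> hline R) (z0 : R * R)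
    (A : set (rbar R)) : rbar_borel A ->
  measurable [set j : path_space | exists2 l, conv_to (walk L z0 j) l & A l].
Proof.
apply: (@measurable_limit_event _ _ path_space (fun m j => walk L z0 j m)).
move=> m S; apply: (measurable_prefix_dependent m) => i j ij /=.
by rewrite (walk_prefix _ _ _ _ _ _ ij).
Qed.

(** * Law of the index sequence and of its shift *)

Section Probability.
Context {R : realType} {d : measure_display} {T : measurableType d}.
Variable P : probability T R.

Lemma ae_eq_measure (X Y : set T) : measurable X -> measurable Y ->
  {ae P, forall w, X w <-> Y w} -> P X = P Y.
Proof.
move=> mX mY [N [mN N0 XYN]].
(* Adjoining the null set absorbs every point of disagreement. *)
have XN : X `|` N = Y `|` N.
  have XY w : ~ N w -> (X w <-> Y w).
    by move=> Nw; apply: contrapT => h; apply: Nw; exact: XYN.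
  apply/seteqP; split=> w; have [Nw|/XY[h1 h2]] := pselect (N w);
    by [right|case; [left; auto|right]].
by rewrite -(measureU0 mX mN N0) XN measureU0.
Qed.

Variable ii : nat -> T -> 'I_3.
Hypothesis iid : iid_uniform3 P ii.

Let path (w : T) : path_space := fun k => ii k w.
Let shifted_path (w : T) : path_space := fun k => ii k.+1 w.

Lemma measurable_path_from n :
  measurable_fun setT (fun w => (fun k => ii (n + k) w) : path_space).
Proof.
apply: (@measurability _ _ T path_space _ _ prefix_cylinders erefl).
move=> _ [B [->|[m [c ->]]] <-]; first by rewrite preimage_set0 setI0.
rewrite setTI (_ : _ @^-1` _ =
    \bigcap_(k in [set k | (k < m)%N]) (ii (n + k) @^-1` [set c k])).
  by apply: fin_bigcap_measurable => // k _; exact: iid.1.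
by apply/seteqP; split=> w /= h k; exact: h.
Qed.

Lemma measurable_path : measurable_fun setT path.
Proof. exact: (measurable_path_from 0). Qed.

Lemma measurable_shifted_path : measurable_fun setT shifted_path.
Proof. exact: (measurable_path_from 1). Qed.

Lemma measure_partition_first (X : set T) : measurable X ->
  P X = (\sum_(c < 3) P (ii 0 @^-1` [set c] `&` X))%E.
Proof.
move=> mX.
rewrite {1}(_ : X = \bigcup_(c in [set: 'I_3]) (ii 0 @^-1` [set c] `&` X)).
  rewrite measure_fin_bigcup//.
  - by rewrite (fsbigE (index_enum 'I_3)) ?index_enum_uniq//=;
      [apply: eq_bigl => c; rewrite in_setT|
       move=> c _; rewrite mem_index_enum].
  - exact: finite_finset.
  - by move=> c e _ _ [w [[/= <- _] [/= <- _]]].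
  - by move=> c _; apply: measurableI => //; exact: iid.1.
by apply/seteqP; split=> [w Xw|w [c _ []//]]; exists (ii 0 w).
Qed.

(** Dynkin's uniqueness theorem on the pi-system of cylinders. General measures are allowed so that
    a restriction of [P] can be compared with a multiple of [P]. *)
Lemma path_law_unique (mu nu : {measure set T -> \bar R}) (f g : T -> path_space) :
  measurable_fun setT f -> measurable_fun setT g -> (mu setT < +oo)%E ->
  (forall n c, mu (f @^-1` prefix_cylinder n c) =
               nu (g @^-1` prefix_cylinder n c)) ->
  forall B, measurable B -> mu (f @^-1` B) = nu (g @^-1` B).
Proof.
move=> mf mg muoo mn B mB.
(* The measure structure of a pushforward takes the measurability proof as an
   argument, so unification cannot infer it. *)
pose m1 := measure_function_pushforward__canonical__measure_function_Measure mu mf.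
pose m2 := measure_function_pushforward__canonical__measure_function_Measure nu mg.
(* The cylinder of length zero is the whole space and provides the exhausting sequence. *)
have cylT : prefix_cylinder 0 (fun=> ord0) = setT by apply/seteqP; split.
rewrite -[LHS]/(m1 B) -[RHS]/(m2 B).
apply: (@measure_unique _ R path_space prefix_cylinders (fun=> setT)) => //.
- exact: setI_closed_prefix_cylinders.
- by move=> _; right; exists 0, (fun=> ord0); rewrite cylT.
- by rewrite bigcup_const//; exists 0.
- move=> _ [->|[n [c ->]]]; first by rewrite !measure0.
  exact: mn.
Qed.

Lemma prefix_cylinder_prob (s : seq nat) (c : nat -> 'I_3) : uniq s ->
  P [set w | forall k, k \in s -> ii k w = c k] = (3%:R^-1 ^+ size s)%:E.
Proof. by move=> us; rewrite -(iid.2 s c us). Qed.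

(** Both sides are measures in [B]: [P] restricted to first index [c] and pushed along the shift,
    and one third of the path law. On a cylinder of length [n] each equals [3^-(n+1)]. *)
Lemma first_step_independent (c : 'I_3) (B : set path_space) : measurable B ->
  P (ii 0 @^-1` [set c] `&` shifted_path @^-1` B) =
  ((3%:R^-1)%:E * P (path @^-1` B))%E.
Proof.
move=> mB; have m0 := iid.1 0 c.
have third_ge0 : 0 <= 3%:R^-1 :> R by rewrite invr_ge0.
rewrite setIC.
apply: (path_law_unique (mrestr P m0) (mscale (NngNum third_ge0) P)) => //.
- exact: measurable_shifted_path.
- exact: measurable_path.
- rewrite /= /mrestr setTI.
  by apply: le_lt_trans (probability_le1 P m0) _; rewrite ltry.
- move=> n e; rewrite /= /mrestr /mscale /=.
  have -> : path @^-1` prefix_cylinder n e =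
      [set w | forall k, k \in iota 0 n -> ii k w = e k].
    by apply/seteqP; split=> w /= h k; [rewrite mem_iota => /h|
      move=> kn; apply: h; rewrite mem_iota].
  (* Prepending [c] to the prefix [e] turns the joint event into one cylinder condition of length
     [n.+1]. *)
  have -> : shifted_path @^-1` prefix_cylinder n e `&` ii 0 @^-1` [set c] =
      [set w | forall k, k \in iota 0 n.+1 ->
         ii k w = if k is k'.+1 then e k' else c].
    apply/seteqP; split=> w /=.
      by move=> [h h0] [|k]; rewrite // in_cons mem_iota => /h.
    by move=> h; split=> [k kn|]; [apply: (h k.+1)|exact: (h 0)];
      rewrite in_cons mem_iota //=.
  rewrite !prefix_cylinder_prob ?iota_uniq// !size_iota exprS.
  by rewrite EFinM.
Qed.

Lemma shifted_path_law (B : set path_space) : measurable B ->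
  P (shifted_path @^-1` B) = P (path @^-1` B).
Proof.
move=> mB; rewrite measure_partition_first; last first.
  by rewrite -[X in measurable X]setTI; exact: measurable_shifted_path.
under eq_bigr do rewrite first_step_independent//.
rewrite -ge0_sume_distrl; last by move=> c _; rewrite lee_fin invr_ge0.
by rewrite sumEFin sumr_const card_ord -[X in X%:E]mulr_natr mulVf ?mul1e.
Qed.

End Probability.

(** * Stationarity of the limit law *)

Theorem mainTheorem3 (R : realType) (L : 'I_3 -> hline R) (z0 : R * R)
  (d : measure_display) (T : measurableType d) (P : probability T R)
  (ii : nat -> T -> 'I_3) (zeta : T -> rbar R) :
  (forall i, valid_line (L i)) ->
  inH z0 ->
  (forall i i' : 'I_3, i != i' -> pair_ok (L i) (L i') z0) ->
  iid_uniform3 P ii ->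
  (forall A, rbar_borel A -> measurable (zeta @^-1` A)) ->
  {ae P, forall w, conv_to (walk L z0 (fun k => ii k w)) (zeta w)} ->
  forall A, rbar_borel A ->
    P (zeta @^-1` A) =
      (((3%:R : R)^-1)%:E *
        \sum_(i < 3) P (zeta @^-1` (oneway_bd (L i) z0 @^-1` A)))%E.
Proof.
move=> vL _ _ iid mzeta zetaP A bA.
pose path w : path_space := fun k => ii k w.
pose shifted_path w : path_space := fun k => ii k.+1 w.
pose lim_in (B : set (rbar R)) : set path_space :=
  [set j | exists2 l, conv_to (walk L z0 j) l & B l].
have mpath B : rbar_borel B -> measurable (path @^-1` lim_in B).
  move=> bB; rewrite -[X in measurable X]setTI.
  by apply: (measurable_path _ _ iid) => //; exact: measurable_walk_limit.
have mshift B : rbar_borel B -> measurable (shifted_path @^-1` lim_in B).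
  move=> bB; rewrite -[X in measurable X]setTI.
  by apply: (measurable_shifted_path _ _ iid) => //; exact: measurable_walk_limit.
have zeta_law B : rbar_borel B -> P (zeta @^-1` B) = P (path @^-1` lim_in B).
  move=> bB; apply: ae_eq_measure; [exact: mzeta|exact: mpath|].
  apply: filterS zetaP => w zw; split=> [Bz|[l zl Bl]]; first by exists (zeta w).
  by rewrite /= (conv_to_unique _ _ _ zw zl).
have bT : rbar_borel [set: rbar R] by exact: measurableT.
(* Convergence has probability one along the original path, as witnessed by [zeta], and the shift
   preserves the probability of this event. *)
have shift_cv : {ae P, forall w, lim_in setT (shifted_path w)}.
  exists (~` (shifted_path @^-1` lim_in setT)); split.
  - by apply: measurableC; exact: mshift.
  - rewrite probability_setC; last exact: mshift.
    rewrite (shifted_path_law _ _ iid); last exact: measurable_walk_limit.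
    by rewrite -zeta_law// preimage_setT probability_setT subee.
  - by [].
rewrite (measure_partition_first _ _ iid); last exact: mzeta.
rewrite ge0_sume_distrr//; apply: eq_bigr => c _.
have bc : rbar_borel (oneway_bd (L c) z0 @^-1` A) by exact: rbar_borel_oneway.
(* One third of the probability for the original path becomes the joint probability that the first
   index is [c] and the shifted walk converges into the preimage of [A]. *)
rewrite zeta_law// -(first_step_independent _ _ iid c); last first.
  exact: measurable_walk_limit.
apply: ae_eq_measure.
- by apply: measurableI; [exact: iid.1|exact: mzeta].
- by apply: measurableI; [exact: iid.1|exact: mshift].
(* Where both walks converge, uniqueness of limits identifies [zeta w] with the image of [l] under
   the first one-way reflection, so the two events agree. *)
apply: filterS2 zetaP shift_cv => w zw [l sl _].
have := conv_to_walkS _ _ _ (fun k => ii k w) _ vL sl.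
move=> /(conv_to_unique _ _ _ zw) zE; split=> -[/= iw].
  by rewrite zE iw => Al; split=> //; exists l.
move=> [l' sl' Al']; split=> //.
by rewrite zE iw (conv_to_unique _ _ _ sl sl').
Qed.
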